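(* Let $n>d\ge1$, let $A\in\mathbb{R}^{n\times d}$ be full rank, $b\in\mathbb{R}^n$, and $U = \operatorname{span}(\operatorname{range}(A),b)$. Let $\alpha\in(0,1]$ and $\delta\in[0,1)$. Suppose the random matrix $\Omega\in\mathbb{R}^{n\times k}$ satisfies $\mathbb{E}[\Omega\Omega^\top] = I_n$ and \[ \mathbb{P}\left\{\|\Omega^\top u\|_2^2 \ge \alpha \|u\|_2^2\ \text{ for all } u \in U\right\}\ge 1 - \delta . \] Then, for every $\eta\in(0,1)$, \[ \mathbb{P}\left\{\|A\widetilde x-b\|_2^2\le\left(1+\frac{1-\alpha+\alpha\delta}{4\alpha\eta}\right)\|Ax_\star-b\|_2^2\right\}\ge 1-\delta-\eta . \] Moreover, any $(d+1,\alpha,\delta)$-OSI $\Omega\in\mathbb{R}^{n\times k}$ satisfies $\mathbb{E}[\Omega\Omega^\top] = I_n$ and $\mathbb{P}\left\{\|\Omega^\top u\|_2^2 \ge \alpha \|u\|_2^2\ \text{ for all } u \in U\right\}\ge 1 - \delta$ (extending $U$ to a $(d+1)$-dimensional subspace if $\dim U<d+1$).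
   Context: Here $x_\star\in\operatorname{argmin}_{x\in\mathbb{R}^d}\|Ax-b\|_2$ is a least-squares solution, and $\widetilde x\in\operatorname{argmin}_{x\in\mathbb{R}^d}\|\Omega^\top(Ax-b)\|_2$ is the sketch-and-solve estimator. Definition (oblivious subspace injection, OSI). Fix integers $1\le s\le n$ and $k\ge1$, an injectivity parameter $\alpha\in(0,1]$, and a failure parameter $\rho\in[0,1)$. A random matrix $\Omega\in\mathbb{R}^{n\times k}$ is an $(s,\alpha,\rho)$-OSI if (i) (isotropy) $\mathbb{E}[\Omega\Omega^\top]=I_n$; and (ii) (injectivity) for every fixed $s$-dimensional subspace $V\subseteq\mathbb{R}^n$, $\mathbb{P}\{\|\Omega^\top x\|_2^2\ge\alpha\|x\|_2^2\text{ for all }x\in V\}\ge1-\rho$. *)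

(* Defs.v *)
From HB Require Import structures.
From mathcomp Require Import all_boot all_order all_algebra.
From mathcomp Require Import all_classical all_reals all_analysis.

Set Implicit Arguments.
Unset Strict Implicit.
Unset Printing Implicit Defensive.

Import Order.TTheory GRing.Theory Num.Theory.
Local Open Scope classical_set_scope.
Local Open Scope ring_scope.

(* The library norm `|x| on matrices is the sup norm, hence this definition. *)
Definition norm2 (R : realType) (n : nat) (x : 'cV[R]_n) : R :=
  Num.sqrt (\sum_(i < n) x i 0 ^+ 2).

Definition argmin (X : Type) (R : realType) (f : X -> R) : set X :=
  [set x | forall y, f x <= f y].

Definition range_mx (R : realType) (n d : nat) (A : 'M[R]_(n, d)) :
    {vspace 'cV[R]_n} :=
  limg (linfun (mulmx A : 'cV[R]_d -> 'cV[R]_n)).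

(* Measurability for the product (equivalently Borel) sigma-algebra on
   matrices. *)
Definition random_matrix (R : realType) (dsp : measure_display)
    (T : measurableType dsp) (m p : nat) (X : T -> 'M[R]_(m, p)) : Prop :=
  forall i j, measurable_fun [set: T] (fun w => X w i j).

Definition expectation_mx (R : realType) (dsp : measure_display)
    (T : measurableType dsp) (P : probability T R) (m p : nat)
    (X : T -> 'M[R]_(m, p)) : 'M[\bar R]_(m, p) :=
  \matrix_(i, j) ('E_P[fun w => X w i j])%E.

(* Equality with a finite matrix includes the finiteness of all second moments
   of the entries of Omega (diagonal entries), hence integrability of every
   entry of Omega Omega^T. *)
Definition isotropic (R : realType) (dsp : measure_display)
    (T : measurableType dsp) (P : probability T R) (n k : nat)
    (Omega : T -> 'M[R]_(n, k)) : Prop :=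
  expectation_mx P (fun w => Omega w *m (Omega w)^T) = map_mx EFin 1%:M.

Definition injectivity_event (R : realType) (dsp : measure_display)
    (T : measurableType dsp) (n k : nat) (Omega : T -> 'M[R]_(n, k))
    (alpha : R) (V : {vspace 'cV[R]_n}) : set T :=
  [set w | forall x : 'cV[R]_n, x \in V ->
     alpha * norm2 x ^+ 2 <= norm2 ((Omega w)^T *m x) ^+ 2].

Record OSI (R : realType) (dsp : measure_display) (T : measurableType dsp)
    (P : probability T R) (n k s : nat) (alpha rho : R)
    (Omega : T -> 'M[R]_(n, k)) : Prop := {
  osi_dim : (1 <= s <= n)%N ;
  osi_cols : (1 <= k)%N ;
  osi_alpha : 0 < alpha <= 1 ;
  osi_rho : 0 <= rho < 1 ;
  osi_measurable : random_matrix Omega ;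
  osi_isotropy : isotropic P Omega ;
  osi_injectivity : forall V : {vspace 'cV[R]_n}, \dim V = s ->
    ((1 - rho)%:E <= P (injectivity_event Omega alpha V))%E }.

(* Main.v *)
Require Import Defs.
From HB Require Import structures.
From mathcomp Require Import all_boot all_order all_algebra.
From mathcomp Require Import all_classical all_reals all_analysis.
From mathcomp Require Import measurable_realfun ring lra.

Set Implicit Arguments.
Unset Strict Implicit.
Unset Printing Implicit Defensive.

Import Order.TTheory GRing.Theory Num.Theory.
Import numFieldNormedType.Exports.
Local Open Scope classical_set_scope.
Local Open Scope ring_scope.

(* Write [S] for the transpose of [Omega w], [r = b - A xstar] and
   [e = A (xtilde - xstar)], so that [|A xtilde - b|^2 = |r|^2 + |e|^2].
   Injectivity at the reflected vector [r - 2 e] gives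
   [4 alpha |e|^2 <= |S r|^2 - alpha |r|^2].  The right-hand side has mean
   [(1 - alpha) |r|^2] by isotropy, is nonnegative on the injectivity event and
   at least [- alpha |r|^2] off it, so Markov's inequality on that event bounds
   it by [(1 - alpha + alpha delta) |r|^2 / eta] with failure probability at
   most [eta]. *)

(** * Euclidean geometry and the normal equations of least squares *)

Section Dot.
Variable R : realType.
Implicit Types n : nat.

Definition dot (n : nat) (x y : 'cV[R]_n) : R := (x^T *m y) 0 0.

Lemma dotE n (x y : 'cV[R]_n) : dot x y = \sum_i x i 0 * y i 0.
Proof. by rewrite /dot mxE; apply: eq_bigr => i _; rewrite mxE. Qed.

Lemma dotC n (x y : 'cV[R]_n) : dot x y = dot y x.
Proof. by rewrite !dotE; apply: eq_bigr => i _; rewrite mulrC. Qed.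

Lemma dotDr n (x y z : 'cV[R]_n) : dot x (y + z) = dot x y + dot x z.
Proof. by rewrite /dot mulmxDr mxE. Qed.

Lemma dotZr n a (x y : 'cV[R]_n) : dot x (a *: y) = a * dot x y.
Proof. by rewrite /dot -scalemxAr mxE. Qed.

Lemma dotDl n (x y z : 'cV[R]_n) : dot (y + z) x = dot y x + dot z x.
Proof. by rewrite !(dotC _ x) dotDr. Qed.

Lemma dotZl n a (x y : 'cV[R]_n) : dot (a *: y) x = a * dot y x.
Proof. by rewrite !(dotC _ x) dotZr. Qed.

Lemma dotNr n (x y : 'cV[R]_n) : dot x (- y) = - dot x y.
Proof. by rewrite -scaleN1r dotZr mulN1r. Qed.

Lemma dotNl n (x y : 'cV[R]_n) : dot (- y) x = - dot y x.
Proof. by rewrite !(dotC _ x) dotNr. Qed.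

Lemma dot_suml n (I : finType) (F : I -> 'cV[R]_n) x :
  dot (\sum_i F i) x = \sum_i dot (F i) x.
Proof. by rewrite /dot raddf_sum mulmx_suml summxE. Qed.

Lemma dot_sumr n (I : finType) (F : I -> 'cV[R]_n) x :
  dot x (\sum_i F i) = \sum_i dot x (F i).
Proof. by rewrite dotC dot_suml; apply: eq_bigr => i _; rewrite dotC. Qed.

Definition dot_linE := (dotDr, dotDl, dotNr, dotNl, dotZr, dotZl).

Lemma pythagoras n (x y : 'cV[R]_n) :
  dot x y = 0 -> dot (x - y) (x - y) = dot y y + dot x x.
Proof. by move=> xy0; rewrite !dot_linE (dotC y x) xy0; ring. Qed.

Lemma dot_ge0 n (x : 'cV[R]_n) : 0 <= dot x x.
Proof. by rewrite dotE; apply: sumr_ge0 => i _; rewrite -expr2 sqr_ge0. Qed.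

Lemma sqr_norm2 n (x : 'cV[R]_n) : norm2 x ^+ 2 = dot x x.
Proof.
rewrite /norm2 sqr_sqrtr; last by apply: sumr_ge0 => i _; rewrite sqr_ge0.
by rewrite dotE.
Qed.

Lemma ler_norm2 n (x y : 'cV[R]_n) :
  (norm2 x <= norm2 y) = (dot x x <= dot y y).
Proof. by rewrite -!sqr_norm2 ler_pXn2r // nnegrE sqrtr_ge0. Qed.

(** Along each line [x0 + t *: y] the squared residual is a quadratic in [t] with minimum at
    [t = 0], so its linear coefficient vanishes. A general [M] serves both the original and the
    sketched problem. *)
Lemma argmin_residual_orthogonal m p (M : 'M[R]_(m, p)) c x0 :
    argmin (fun x : 'cV[R]_p => norm2 (M *m x - c)) x0 ->
  forall y, dot (M *m y) (M *m x0 - c) = 0.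
Proof.
move=> x0_min y; set e := M *m y; set r := M *m x0 - c.
have qmin t : 0 <= 2 * t * dot e r + t ^+ 2 * dot e e.
  have := x0_min (x0 + t *: y).
  rewrite ler_norm2 mulmxDr -scalemxAr addrAC -/e -/r.
  clearbody e r; rewrite !dot_linE (dotC r e).
  by rewrite -subr_ge0; congr (_ <= _); ring.
have e_ge0 := dot_ge0 e.
(* The exact minimiser has denominator [dot e e], which may be zero. Adding 1 avoids the case split
   and still makes the value negative unless [dot e r = 0]. *)
have := qmin (- dot e r / (1 + dot e e)).
have d_gt0 : 0 < 1 + dot e e by lra.
set a := dot e r; set q := dot e e in d_gt0 e_ge0 *.
have -> : 2 * (- a / (1 + q)) * a + (- a / (1 + q)) ^+ 2 * q =
   - (a ^+ 2 * ((2 + q) / (1 + q) ^+ 2)) by field; lra.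
rewrite oppr_ge0 pmulr_lle0; last by rewrite divr_gt0 ?exprn_gt0 //; lra.
by move=> a2_le0; apply/eqP; rewrite -sqrf_eq0 eq_le a2_le0 sqr_ge0.
Qed.

(* The sketch of [e] is the orthogonal projection of the sketch of [r], so the
   sketch of the reflected vector [r - 2 e] is as long as that of [r]. *)
Lemma sketched_error_bound n k (S : 'M[R]_(k, n)) (alpha : R) (e r : 'cV[R]_n) :
    dot e r = 0 ->
    dot (S *m e) (S *m (e - r)) = 0 ->
    alpha * dot (r - 2 *: e) (r - 2 *: e) <=
      dot (S *m (r - 2 *: e)) (S *m (r - 2 *: e)) ->
  4 * alpha * dot e e <= dot (S *m r) (S *m r) - alpha * dot r r.
Proof.
move=> er0; rewrite !mulmxBr -!scalemxAr !dot_linE (dotC r e) er0.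
rewrite (dotC (S *m r) (S *m e)) => proj inj.
lra.
Qed.

End Dot.

(** * Extension of a subspace to a prescribed dimension *)

Lemma exists_superspace (K : fieldType) (vT : vectType K) (U : {vspace vT}) s :
  (\dim U <= s <= \dim {:vT})%N -> exists2 V, (U <= V)%VS & \dim V = s.
Proof.
(* Adjoin to [U] the first [s - \dim U] basis vectors of a complement. *)
case/andP=> Us sT; pose X := take (s - \dim U) (vbasis U^C).
have dimUC : \dim U^C = (\dim {:vT} - \dim U)%N by rewrite dimv_compl.
have freeX : free X.
  have := basis_free (vbasisP U^C).
  by rewrite -{1}(cat_take_drop (s - \dim U) (vbasis U^C)) => /catl_free.
have dimX : \dim <<X>> = (s - \dim U)%N.
  move/eqP: freeX => ->; rewrite size_take_min size_tuple dimUC.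
  by apply/minn_idPl; exact: leq_sub2r.
have XUC : (<<X>> <= U^C)%VS.
  by apply/span_subvP => v /mem_take; exact: vbasis_mem.
exists (U + <<X>>)%VS; first exact: addvSl.
rewrite dimv_disjoint_sum ?dimX ?subnKC //.
apply/eqP; rewrite -subv0 -(capv_compl U); exact: capvS.
Qed.

(** * Measurability of matrix operations *)

Section RandomMatrices.
Context (R : realType) (dsp : measure_display) (T : measurableType dsp).

Lemma random_matrix_cst m p (M : 'M[R]_(m, p)) :
  random_matrix (fun _ : T => M).
Proof. by move=> i j; exact: measurable_cst. Qed.

Lemma random_matrix_tr m p (X : T -> 'M[R]_(m, p)) :
  random_matrix X -> random_matrix (fun w => (X w)^T).
Proof.
move=> mX i j; rewrite (_ : (fun w => _) = (fun w => X w j i)) //.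
by apply/funext => w; rewrite mxE.
Qed.

Lemma random_matrixD m p (X Y : T -> 'M[R]_(m, p)) :
  random_matrix X -> random_matrix Y -> random_matrix (fun w => X w + Y w).
Proof.
move=> mX mY i j; rewrite (_ : (fun w => _) = (fun w => X w i j + Y w i j)).
  exact: measurable_funD.
by apply/funext => w; rewrite mxE.
Qed.

Lemma random_matrixM m p q (X : T -> 'M[R]_(m, p)) (Y : T -> 'M[R]_(p, q)) :
  random_matrix X -> random_matrix Y -> random_matrix (fun w => X w *m Y w).
Proof.
move=> mX mY i j.
rewrite (_ : (fun w => _) = (fun w => \sum_l X w i l * Y w l j)).
  by apply: measurable_sum => l; exact: measurable_funM.
by apply/funext => w; rewrite mxE.
Qed.

Lemma measurable_dot n (X Y : T -> 'cV[R]_n) :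
    random_matrix X -> random_matrix Y ->
  measurable_fun [set: T] (fun w => dot (X w) (Y w)).
Proof. by move=> mX mY; exact: random_matrixM (random_matrix_tr mX) mY 0 0. Qed.

Lemma measurable_ler_fun (f g : T -> R) :
    measurable_fun [set: T] f -> measurable_fun [set: T] g ->
  measurable [set w | f w <= g w].
Proof.
move=> mf mg; rewrite -[X in measurable X]setTI.
exact: (measurable_fun_ler mf mg measurableT (Y := [set true])).
Qed.

End RandomMatrices.

(** * Passing from rational to real coordinates *)

Lemma exists_rat_cvg (R : realType) (x : R) :
  exists u : nat -> rat, (fun N => ratr (u N) : R) @ \oo --> x.
Proof.
have /choice[u uP] (N : nat) : exists q : rat, ratr q \in `]x, x + harmonic N[.
  by apply: rat_in_itvoo; rewrite ltrDl invr_gt0 ltr0n.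
exists u; apply: (@squeeze_cvgr _ _ _ _ (cst x) (fun N => x + harmonic N)).
- by near=> N; have /[!in_itv]/= /andP[/ltW -> /ltW ->] := uP N.
- exact: cvg_cst.
- by rewrite -[X in _ --> X]addr0; apply: cvgD; [exact: cvg_cst|exact: cvg_harmonic].
Unshelve. all: by end_near. Qed.

(** The form is continuous in its coordinates and the half-line of nonnegative reals is closed, so
    the sign survives limits of rational points. *)
Lemma quadratic_form_ge0_from_rat (R : realType) m (q : 'I_m -> 'I_m -> R) :
    (forall z : {ffun 'I_m -> rat},
       0 <= \sum_i \sum_j ratr (z i) * ratr (z j) * q i j) ->
  forall x : 'I_m -> R, 0 <= \sum_i \sum_j x i * x j * q i j.
Proof.
move=> q_ge0 x; have /choice[u ux] i := exists_rat_cvg (x i).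
have lim_q : (fun N => \sum_i \sum_j ratr (u i N) * ratr (u j N) * q i j) @ \oo
    --> \sum_i \sum_j x i * x j * q i j.
  apply: cvg_big => [|i _]; first exact: add_continuous.
  apply: cvg_big => [|j _]; first exact: add_continuous.
  by apply: cvgM; [apply: cvgM; exact: ux | exact: cvg_cst].
apply: (closed_cvg (fun y : R => 0 <= y) _ _ _ lim_q); first exact: closed_ge.
near=> N; have := q_ge0 [ffun i => u i N].
by under eq_bigr do under eq_bigr do rewrite !ffunE.
Unshelve. all: by end_near. Qed.

(** * Measurability of the injectivity event *)

Section Events.
Context (R : realType) (dsp : measure_display) (T : measurableType dsp).
Context (n k : nat) (Omega : T -> 'M[R]_(n, k)).

(* Only countably many vectors need testing, whence measurability. *)
Lemma injectivity_eventE (alpha : R) (V : {vspace 'cV[R]_n}) :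
  injectivity_event Omega alpha V = \bigcap_(z : {ffun 'I_(\dim V) -> rat})
    let v := \sum_i ratr (z i) *: (vbasis V)`_i in
    [set w | alpha * dot v v <= dot ((Omega w)^T *m v) ((Omega w)^T *m v)].
Proof.
apply/seteqP; split=> [w inj z _ /=|w inj v Vv].
  rewrite -!sqr_norm2; apply: inj.
  by apply: memv_suml => i _; rewrite memvZ // vbasis_mem // mem_nth ?size_tuple.
rewrite !sqr_norm2 -subr_ge0.
pose S := (Omega w)^T; pose b (i : 'I_(\dim V)) := (vbasis V)`_i.
(* In coordinates on [vbasis V], the difference of the two sides of the injectivity inequality is
   the quadratic form with matrix [q]. *)
pose q i j := dot (S *m b i) (S *m b j) - alpha * dot (b i) (b j).
have qE (x : 'I_(\dim V) -> R) (y := \sum_i x i *: b i) :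
    dot (S *m y) (S *m y) - alpha * dot y y = \sum_i \sum_j x i * x j * q i j.
  rewrite /y mulmx_sumr !dot_suml mulr_sumr -sumrB; apply: eq_bigr => i _.
  rewrite !dot_sumr mulr_sumr -sumrB; apply: eq_bigr => j _.
  by rewrite -!scalemxAr !dotZl !dotZr /q; ring.
rewrite (coord_vbasis Vv) qE; apply: quadratic_form_ge0_from_rat => z.
by rewrite -qE subr_ge0; exact: inj.
Qed.

Hypothesis Omega_rm : random_matrix Omega.

Lemma random_sketch (v : 'cV[R]_n) :
  random_matrix (fun w => (Omega w)^T *m v).
Proof.
by apply: random_matrixM; [exact: random_matrix_tr|exact: random_matrix_cst].
Qed.

Lemma measurable_injectivity_event (alpha : R) (V : {vspace 'cV[R]_n}) :
  measurable (injectivity_event Omega alpha V).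
Proof.
rewrite injectivity_eventE -[X in measurable X]setCK setC_bigcap.
apply: measurableC; apply: countable_bigcupT_measurable => [|z].
  exact: countableP.
apply: measurableC; apply: measurable_ler_fun; first exact: measurable_cst.
by apply: measurable_dot; exact: random_sketch.
Qed.

End Events.

(** * Markov's inequality and second moments of the sketch *)

Section Probability.
Context (R : realType) (dsp : measure_display) (T : measurableType dsp).
Variable P : probability T R.

(* The strict inequality makes the bound hold also for [K = 0], where it says
   that [f] vanishes almost surely. *)
Lemma markov_strict (f : T -> R) (K eta : R) :
    measurable_fun [set: T] f -> (forall w, 0 <= f w) ->
    (\int[P]_w (f w)%:E <= K%:E)%E -> 0 < eta ->
  (P [set w | (K / eta < f w)%R] <= eta%:E)%E.
Proof.
move=> mf f_ge0 fK eta_gt0.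
have mB (c : R) : measurable [set w | c < f w].
  rewrite (_ : [set _ | _] = ~` [set w | f w <= cst c w]).
    by apply: measurableC; exact: measurable_ler_fun.
  by apply/seteqP; split=> w /=; rewrite ltNge => /negP.
have mEf : measurable_fun [set: T] (fun w => (f w)%:E) by exact/measurable_EFinP.
have K_ge0 : 0 <= K.
  by rewrite -lee_fin (le_trans _ fK) // integral_ge0 // => w _; rewrite lee_fin.
(* If [K = 0], then [f] is nonnegative with zero integral, so it vanishes almost everywhere and the
   event is negligible. *)
have [K_gt0|] := ltrP 0 K; last first.
  move=> K_le0; have {K_le0 K_ge0} K0 : K = 0 by apply/eqP; rewrite eq_le K_le0.
  have f_ae0 : ae_eq P [set: T] (fun w => (f w)%:E) (cst 0%E).
    apply/ae_eq_integral_abs => //; apply/eqP; rewrite eq_le; apply/andP; split.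
      under eq_integral do rewrite gee0_abs ?lee_fin //.
      by rewrite (le_trans fK) // K0.
    exact: integral_ge0.
  rewrite (measure_negligible (mB _)) ?lee_fin ?ltW //.
  case: f_ae0 => N [mN PN fN]; exists N; split=> // w /=; rewrite K0 mul0r => fw.
  by apply: fN => /= /(_ I) [f0]; rewrite f0 ltxx in fw.
have c_gt0 : 0 < K / eta by exact: divr_gt0.
(* After scaling by [K / eta], the claim follows by comparing [f] with [K / eta] times the indicator
   of the event. *)
rewrite -(lee_pmul2l (_ : (K / eta)%:E \is a fin_num)) ?lte_fin //.
apply: le_trans (_ : K%:E <= _)%E; last by rewrite -EFinM divfK // gt_eqF.
apply: le_trans fK; rewrite -[X in P X]setIT -integral_indic //.
rewrite -integralZl //; last exact: integrable_indic.
apply: ge0_le_integral => //.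
- by move=> w _; rewrite lee_fin mulr_ge0 // ltW.
- exact: measurable_int (integrableZl measurableT _ (integrable_indic P (mB _))).
move=> w _; rewrite -EFinM lee_fin indicE.
have [/set_mem/ltW ?|_] := boolP (w \in _); by rewrite ?mulr1 ?mulr0.
Qed.

(** Diagonal entries are nonnegative with finite integral, hence integrable. Since
    [|x y| <= x^2 + y^2], each entry is dominated by the sum of two diagonal ones. *)
Lemma isotropic_gram n k (Omega : T -> 'M[R]_(n, k)) :
    random_matrix Omega -> isotropic P Omega -> forall i j,
  P.-integrable [set: T] (fun w => ((Omega w *m (Omega w)^T) i j)%:E) /\
  (\int[P]_w ((Omega w *m (Omega w)^T) i j)%:E = ((i == j)%:R : R)%:E)%E.
Proof.
move=> mO iso; pose G i j w := (Omega w *m (Omega w)^T) i j.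
have mG i j : measurable_fun [set: T] (G i j).
  exact: random_matrixM mO (random_matrix_tr mO) i j.
have mEG i j : measurable_fun [set: T] (fun w => (G i j w)%:E).
  by apply/measurable_EFinP; exact: mG.
have intG i j : (\int[P]_w (G i j w)%:E = ((i == j)%:R : R)%:E)%E.
  by move/matrixP/(_ i j): iso; rewrite !mxE unlock.
have Gii_ge0 i w : 0 <= G i i w.
  by rewrite /G mxE; apply: sumr_ge0 => l _; rewrite mxE -expr2 sqr_ge0.
have integrable_diag i : P.-integrable [set: T] (fun w => (G i i w)%:E).
  apply/integrableP; split; first exact: mEG.
  under eq_integral do rewrite gee0_abs ?lee_fin //.
  by rewrite intG ltry.
move=> i j; split; last exact: intG.
apply: (le_integrable measurableT _ _
  (integrableD measurableT (integrable_diag i) (integrable_diag j))).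
  exact: mEG.
move=> w _; rewrite -EFinD !abse_EFin lee_fin (ger0_norm (addr_ge0 _ _)) //.
rewrite /G !mxE -big_split /=; apply: le_trans (ler_norm_sum _ _ _) _.
apply: ler_sum => l _; rewrite !mxE normrM.
have sqE x : x * x = `|x| ^+ 2 :> R by rewrite -normrX ger0_norm ?sqr_ge0.
rewrite !sqE.
have := sqr_ge0 (`|Omega w i l| - `|Omega w j l|).
have := normr_ge0 (Omega w i l); have := normr_ge0 (Omega w j l).
nra.
Qed.

(** Writing [Q] as the quadratic form of [Omega Omega^T] at [r] gives a finite sum over index pairs;
    after termwise integration only the diagonal remains. *)
Lemma expectation_sketch n k (Omega : T -> 'M[R]_(n, k)) (r : 'cV[R]_n) :
    random_matrix Omega -> isotropic P Omega ->
  let Q w := dot ((Omega w)^T *m r) ((Omega w)^T *m r) in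
  P.-integrable [set: T] (fun w => (Q w)%:E) /\
  (\int[P]_w (Q w)%:E = (dot r r)%:E)%E.
Proof.
move=> mO iso Q; have gram := isotropic_gram mO iso.
pose G i j w := (Omega w *m (Omega w)^T) i j.
have QE : (fun w => (Q w)%:E) = (fun w => \sum_(p : 'I_n * 'I_n)
    ((r p.1 0 * r p.2 0)%:E * (G p.1 p.2 w)%:E))%E.
  apply/funext => w; under eq_bigr do rewrite -EFinM.
  rewrite sumEFin /Q /dot trmx_mul trmxK -mulmxA (mulmxA (Omega w)); congr (_%:E).
  rewrite mxE -(pair_bigA _ (fun i j => r i 0 * r j 0 * G i j w)) /=.
  apply: eq_bigr => i _; rewrite !mxE mulr_sumr; apply: eq_bigr => j _.
  by rewrite /G; ring.
have intS p : P.-integrable [set: T]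
    (fun w => ((r p.1 0 * r p.2 0)%:E * (G p.1 p.2 w)%:E)%E).
  by apply: integrableZl => //; have [] := gram p.1 p.2.
rewrite QE; split; first exact: integrable_sum.
rewrite integral_sum //.
under eq_bigr => p _.
  have [iG eG] := gram p.1 p.2.
  rewrite integralZl // eG -EFinM; over.
rewrite sumEFin dotE; congr (_%:E).
rewrite -(pair_bigA _ (fun i j => r i 0 * r j 0 * (i == j)%:R)) /=.
apply: eq_bigr => i _; rewrite (bigD1 i) //= eqxx mulr1 big1 ?addr0 //.
by move=> j /negPf ji; rewrite eq_sym ji mulr0.
Qed.

End Probability.

(** * The tail bound and the deterministic error bound *)

Section SketchAndSolve.
Context (R : realType) (dsp : measure_display) (T : measurableType dsp).
Variable P : probability T R.
Context (n k : nat) (Omega : T -> 'M[R]_(n, k)).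
Hypotheses (Omega_rm : random_matrix Omega) (iso : isotropic P Omega).
Variables alpha delta : R.
Hypothesis alpha_gt0 : 0 < alpha.

(* On the injectivity event the excess [|S r|^2 - alpha |r|^2] is nonnegative,
   and cutting it off outside the event increases its mean by at most
   [alpha delta |r|^2], so that Markov's inequality applies. *)
Lemma sketched_excess_tail (U : {vspace 'cV[R]_n}) (r : 'cV[R]_n) (eta : R) :
    r \in U -> 0 < eta ->
    ((1 - delta)%:E <= P (injectivity_event Omega alpha U))%E ->
  ((1 - delta - eta)%:E <= P (injectivity_event Omega alpha U `&`
    [set w | (dot ((Omega w)^T *m r) ((Omega w)^T *m r) - alpha * dot r r <=
      (1 - alpha + alpha * delta) * dot r r / eta)%R]))%E.
Proof.
move=> rU eta_gt0; set E := injectivity_event _ _ _ => PE.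
pose Q w := dot ((Omega w)^T *m r) ((Omega w)^T *m r); pose rho := dot r r.
have mE : measurable E by exact: measurable_injectivity_event.
have mQ : measurable_fun [set: T] Q by apply: measurable_dot; exact: random_sketch.
have [intQ EQ] := expectation_sketch r Omega_rm iso.
have rho_ge0 : 0 <= rho := dot_ge0 r.
pose f w := (Q w - alpha * rho) * \1_E w.
pose K := (1 - alpha + alpha * delta) * rho.
have mf : measurable_fun [set: T] f.
  apply: measurable_funM; last exact: measurable_indic.
  by apply: measurable_funB => //; exact: measurable_cst.
have f_ge0 w : 0 <= f w.
  rewrite /f indicE; have [/set_mem Ew|_] := boolP (w \in E); last by rewrite mulr0.
  by rewrite mulr1 subr_ge0; have := Ew r rU; rewrite !sqr_norm2.
have intE : P.-integrable [set: T] (fun w => (alpha * rho)%:E * (\1_E w)%:E)%E.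
  by apply: integrableZl => //; exact: integrable_indic.
have fK : (\int[P]_w (f w)%:E <= K%:E)%E.
  have PE_fin : P E \is a fin_num by exact: fin_num_measure.
  apply: (@le_trans _ _ (\int[P]_w ((Q w)%:E - (alpha * rho)%:E * (\1_E w)%:E))%E).
    apply: ge0_le_integral => //.
    - by move=> w _; rewrite lee_fin.
    - by apply/measurable_EFinP; exact: mf.
    - exact: measurable_int (integrableB measurableT intQ intE).
    move=> w _; rewrite -EFinM -EFinB lee_fin /f mulrBl lerD2r.
    by rewrite ler_piMr ?dot_ge0 // indicE; case: (_ \in _).
  rewrite integralB // EQ integralZl //; last exact: integrable_indic.
  rewrite integral_indic // setIT -[X in (_ * X)%E](fineK PE_fin).
  move: PE; rewrite -(fineK PE_fin).
  rewrite -EFinM -EFinB !lee_fin -/rho /K => PE.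
  (* This is exactly the gap between [K] and that integral. *)
  have : 0 <= alpha * rho * (fine (P E) - (1 - delta)).
    by rewrite !mulr_ge0 ?subr_ge0 // ltW.
  lra.
have PB := markov_strict mf f_ge0 fK eta_gt0.
set B := [set w | _] in PB.
have mB : measurable B.
  rewrite (_ : B = ~` [set w | f w <= cst (K / eta) w]).
    by apply: measurableC; exact: measurable_ler_fun.
  by apply/seteqP; split=> w; rewrite /B /= ltNge => /negP.
set G := [set w | _].
(* On [E] the cut-off does nothing, so [G] fails there exactly on the Markov event [B]; removing [B]
   costs at most [eta]. *)
have -> : E `&` G = E `\` B.
  have fE w : E w -> f w = Q w - alpha * rho.
    by move=> Ew; rewrite /f indicE mem_set // mulr1.
  apply/seteqP; split=> w [Ew]; rewrite /G /B /= fE // => Gw; split=> //.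
    by rewrite ltNge => /negP; apply.
  by rewrite leNgt; apply/negP.
rewrite measureD //; last by rewrite ltey_eq fin_num_measure.
rewrite EFinB leeB //; apply: le_trans PB.
by apply: le_measure; rewrite ?inE //; exact: measurableI.
Qed.

Variables (d : nat) (A : 'M[R]_(n, d)) (b : 'cV[R]_n).

(** Deterministic, for one outcome [w]: both optimality conditions are tested in the direction
    [xtilde - xstar], injectivity at the reflected vector bounds [dot e e], and Pythagoras adds
    [dot r r]. *)
Lemma sketch_and_solve_error (w : T) (xstar xtilde : 'cV[R]_d) :
    let r := b - A *m xstar in
    injectivity_event Omega alpha (range_mx A + <[b]>)%VS w ->
    argmin (fun x : 'cV[R]_d => norm2 (A *m x - b)) xstar ->
    argmin (fun x : 'cV[R]_d => norm2 ((Omega w)^T *m (A *m x - b))) xtilde ->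
  norm2 (A *m xtilde - b) ^+ 2 <= dot r r +
    (dot ((Omega w)^T *m r) ((Omega w)^T *m r) - alpha * dot r r) / (4 * alpha).
Proof.
set S := (Omega w)^T => r inj xstar_min xtilde_min.
pose e := A *m (xtilde - xstar).
have eE : A *m xtilde - b = e - r by rewrite /e /r mulmxBr opprB addrA subrK.
have Ax_U x : A *m x \in (range_mx A + <[b]>)%VS.
  apply: (subvP (addvSl _ _)); rewrite /range_mx.
  by rewrite -[A *m x](lfunE (mulmx A)) memv_img // memvf.
have b_U : b \in (range_mx A + <[b]>)%VS.
  by apply: (subvP (addvSr _ _)); exact: memv_line.
have er0 : dot e r = 0.
  have /(_ (xtilde - xstar)) := argmin_residual_orthogonal xstar_min.
  by rewrite -[A *m xstar - b]opprB dotNr => /eqP; rewrite oppr_eq0 => /eqP.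
have Ser0 : dot (S *m e) (S *m (e - r)) = 0.
  (* The sketched problem is least squares with matrix [S *m A] and target [S *m b]. *)
  have xtilde_min' : argmin (fun x => norm2 (S *m A *m x - S *m b)) xtilde.
    by move=> y; rewrite -!mulmxA -!mulmxBr; exact: xtilde_min.
  have /(_ (xtilde - xstar)) := argmin_residual_orthogonal xtilde_min'.
  by rewrite -!mulmxA -mulmxBr eE.
have refl_U : r - 2 *: e \in (range_mx A + <[b]>)%VS.
  by rewrite memvB ?memvZ //; [rewrite /r memvB | exact: Ax_U].
have := inj _ refl_U; rewrite !sqr_norm2 => injre.
have := sketched_error_bound er0 Ser0 injre.
rewrite eE (pythagoras er0).
by rewrite lerD2l ler_pdivlMr ?mulr_gt0 // mulrC.
Qed.

End SketchAndSolve.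

(** * Reduction from an OSI, and assembly of the theorem *)

Lemma OSI_injectivity (R : realType) (dsp : measure_display)
    (T : measurableType dsp) (P : probability T R) (n k s : nat)
    (alpha rho : R) (Omega : T -> 'M[R]_(n, k)) (U : {vspace 'cV[R]_n}) :
  OSI P s alpha rho Omega -> (\dim U <= s)%N ->
  ((1 - rho)%:E <= P (injectivity_event Omega alpha U))%E.
Proof.
case=> /andP[_ sn] _ _ _ mO _ inj Us.
(* The bound [s <= n] leaves room for [V]; injectivity on [V] then restricts to [U]. *)
have [|V UV dimV] := @exists_superspace _ _ U s.
  by rewrite Us dimvf /dim /= muln1.
apply: le_trans (inj V dimV) _.
apply: le_measure; rewrite ?inE; try exact: measurable_injectivity_event.
by move=> w injV x Ux; apply: injV; exact: subvP UV x Ux.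
Qed.

Theorem proposition3p3 (R : realType) (dsp : measure_display)
    (T : measurableType dsp) (P : probability T R)
    (n d k : nat) (d_ge1 : (1 <= d)%N) (d_lt_n : (d < n)%N) (k_ge1 : (1 <= k)%N)
    (A : 'M[R]_(n, d)) (A_full : \rank A = d) (b : 'cV[R]_n)
    (alpha delta : R) (alpha_gt0 : 0 < alpha) (alpha_le1 : alpha <= 1)
    (delta_ge0 : 0 <= delta) (delta_lt1 : delta < 1)
    (Omega : T -> 'M[R]_(n, k)) (Omega_rm : random_matrix Omega) :
  let U : {vspace 'cV[R]_n} := (range_mx A + <[b]>)%VS in
  (isotropic P Omega ->
   ((1 - delta)%:E <= P (injectivity_event Omega alpha U))%E ->
   forall xstar : 'cV[R]_d,
     argmin (fun x : 'cV[R]_d => norm2 (A *m x - b)) xstar ->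
   forall xtilde : T -> 'cV[R]_d,
     random_matrix xtilde ->
     (forall w, argmin (fun x : 'cV[R]_d =>
                  norm2 ((Omega w)^T *m (A *m x - b))) (xtilde w)) ->
   forall eta : R, 0 < eta -> eta < 1 ->
     ((1 - delta - eta)%:E <=
      P [set w | (norm2 (A *m xtilde w - b) ^+ 2 <=
        (1 + (1 - alpha + alpha * delta) / (4 * alpha * eta)) *
          norm2 (A *m xstar - b) ^+ 2)%R])%E)
  /\
  (OSI P d.+1 alpha delta Omega ->
     isotropic P Omega /\
     ((1 - delta)%:E <= P (injectivity_event Omega alpha U))%E).
Proof.
move=> U; split; last first.
  move=> osi; split; first exact: osi_isotropy osi.
  apply: OSI_injectivity osi _; apply: leq_trans (dimv_add_leqif _ _) _.
  (* The line of [b] has dimension at most 1, and rank-nullity bounds the dimension of the range by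
     [d]. *)
  rewrite -[d.+1]addn1 leq_add ?dim_vline ?leq_b1 //.
  have := limg_ker_dim (linfun (mulmx A : 'cV[R]_d -> 'cV[R]_n)) fullv.
  by rewrite [X in _ = X]dimvf /dim /= muln1 => dim_eq; rewrite -[leqRHS]dim_eq; exact: leq_addl.
move=> iso PU xstar xstar_min xtilde xtilde_rm xtilde_min eta eta_gt0 _.
pose r := b - A *m xstar.
have rU : r \in U.
  rewrite memvB //; first by apply: (subvP (addvSr _ _)); exact: memv_line.
  apply: (subvP (addvSl _ _)).
  by rewrite -[A *m _](lfunE (mulmx A)) memv_img // memvf.
have rE : norm2 (A *m xstar - b) ^+ 2 = dot r r.
  by rewrite sqr_norm2 -opprB dotNl dotNr opprK.
apply: le_trans (sketched_excess_tail Omega_rm iso alpha_gt0 rU eta_gt0 PU) _.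
have mQ : measurable_fun [set: T]
    (fun w => dot ((Omega w)^T *m r) ((Omega w)^T *m r)).
  by apply: measurable_dot; exact: random_sketch.
apply: le_measure; rewrite ?inE.
- apply: measurableI; first exact: measurable_injectivity_event.
  apply: measurable_ler_fun; last exact: measurable_cst.
  by apply: measurable_funB => //; exact: measurable_cst.
- apply: measurable_ler_fun; last exact: measurable_cst.
  have mres : random_matrix (fun w => A *m xtilde w + - b).
    apply: random_matrixD; last exact: random_matrix_cst.
    by apply: random_matrixM => //; exact: random_matrix_cst.
  rewrite (_ : (fun w => _) =
    (fun w => dot (A *m xtilde w + - b) (A *m xtilde w + - b))).
    exact: measurable_dot.
  by apply/funext => w; rewrite sqr_norm2.
move=> w [injw Qw] /=.
apply: le_trans (sketch_and_solve_error alpha_gt0 injw xstar_min (xtilde_min w)) _.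
rewrite rE -/r [leRHS]mulrDl mul1r lerD2l ler_pdivrMr ?mulr_gt0 //.
(* The tail threshold divided by [4 * alpha] is the stated excess, so the remaining inequality is an
   equality. *)
apply: le_trans Qw _; rewrite le_eqVlt; apply/orP; left; apply/eqP.
by field; rewrite !gt_eqF.
Qed.
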